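(* Let $d\geq 1$ and $R\geq 1$. Let $B\subset A\subset\mathbb{R}^d$ be affine subspaces with $0\leq b=\dim B<a=\dim A\leq d$. Let $\psi,\varphi:[1,+\infty)\to(0,+\infty)$ be decreasing functions with $\varphi(T)\leq\psi(T)$ for all $T\geq 1$ and $\lim_{T\to+\infty}\psi(T)=0$. Suppose that $B$ is $\psi$-badly approximable and that the series $$\sum_{T=1}^{+\infty}\mu_T^{(R)}\lambda_T^{(R)}$$ converges, where for integers $T\geq 1$ $$\mu_T^{(R)}=\left(\frac{T}{\psi(RT)}\right)^{a-b},\qquad \lambda_T^{(R)}=\left(\frac{\varphi(RT)}{T}\right)^{a}-\left(\frac{\varphi(R(T+1))}{T+1}\right)^{a}.$$ Then for Lebesgue-almost all (with respect to $a$-dimensional Lebesgue measure on $A$) vectors ${\bf w}\in A$ with $|{\bf w}|\leq R$, the vector ${\bf w}$ is $\varphi$-badly approximable.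
   Context: For ${\bf x}\in\mathbb{R}^d$ or $\mathbb{R}^{d+1}$ (coordinates $(x_1,\dots,x_d)$, resp. $(x_0,x_1,\dots,x_d)$), $|{\bf x}|$ denotes the sup-norm $\max_j|x_j|$. For an affine subspace $C\subset\mathbb{R}^d$ let $\mathcal{C}=\{(1,x_1,\dots,x_d):(x_1,\dots,x_d)\in C\}\subset\mathbb{R}^{d+1}$ and let $\mathfrak{C}=\mathrm{span}\,\mathcal{C}$ be the smallest linear subspace of $\mathbb{R}^{d+1}$ containing $\mathcal{C}$ (so $\dim\mathfrak{C}=\dim C+1$). Given a positive decreasing function $\psi$, an affine subspace $C\subset\mathbb{R}^d$ is called $\psi$-badly approximable if $$\inf_{{\bf x}\in\mathbb{Z}^{d+1}\setminus\{{\bf 0}\}}\left(\frac{1}{\psi(|{\bf x}|)}\inf_{{\bf y}\in\mathfrak{C}}|{\bf x}-{\bf y}|\right)>0.$$ A vector ${\bf w}\in\mathbb{R}^d$ is called $\psi$-badly approximable if the zero-dimensional affine subspace $\{{\bf w}\}$ is $\psi$-badly approximable, i.e. $\inf_{{\bf x}\in\mathbb{Z}^{d+1}\setminus\{{\bf 0}\}}\left(\frac{1}{\psi(|{\bf x}|)}\inf_{t\in\mathbb{R}}|{\bf x}-t{\bf w}^*|\right)>0$ with ${\bf w}^*=(1,w_1,\dots,w_d)$. *)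

(* Defs.v *)
From HB Require Import structures.
From mathcomp Require Export all_boot all_order all_algebra.
From mathcomp Require Export all_classical all_reals all_analysis.

Set Implicit Arguments.
Unset Strict Implicit.
Unset Printing Implicit Defensive.

Export Order.TTheory GRing.Theory Num.Theory numFieldNormedType.Exports.

Local Open Scope classical_set_scope.
Local Open Scope ring_scope.

(* The norm `|x| on row vectors is the library's, i.e. the sup-norm. *)

Definition affine_subspace (K : realType) (d k : nat) (C : set 'rV[K]_d) : Prop :=
  exists (p : 'rV[K]_d) (V : {vspace 'rV[K]_d}),
    \dim V = k /\ C = [set p + v | v in [set v | v \in V]].

Definition homogenize (K : realType) (d : nat) (w : 'rV[K]_d) : 'rV[K]_(1 + d) :=
  row_mx 1%:M w.

(* The smallest linear subspace containing S, as the intersection of all the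
   linear subspaces containing S. *)
Definition linear_span (K : realType) (n : nat) (S : set 'rV[K]_n) : set 'rV[K]_n :=
  [set y | forall U : {vspace 'rV[K]_n}, (forall s, S s -> s \in U) -> y \in U].

Definition dist_set (K : realType) (n : nat) (x : 'rV[K]_n) (S : set 'rV[K]_n) : K :=
  inf [set `|x - y| | y in S].

Definition int_vec (K : realType) (n : nat) (x : 'rV[int]_n) : 'rV[K]_n :=
  map_mx intr x.
Arguments int_vec : clear implicits.
Arguments int_vec K {n} x.

(* psi stands for a function on [1, +oo[; only its values there matter, since
   a nonzero integer vector has sup-norm at least 1. Both infima range over
   nonempty sets of nonnegative reals, so the real-valued inf is meaningful. *)
Definition badly_approximable (K : realType) (d : nat) (psi : K -> K)
    (C : set 'rV[K]_d) : Prop :=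
  0 < inf [set (psi `|int_vec K x|)^-1
               * dist_set (int_vec K x) (linear_span (@homogenize K d @` C))
          | x in [set x : 'rV[int]_(1 + d) | x != 0]].

Definition badly_approximable_vector (K : realType) (d : nat) (psi : K -> K)
    (w : 'rV[K]_d) : Prop :=
  badly_approximable psi [set w].

Definition box (K : realType) (n : nat) (l u : 'rV[K]_n) : set 'rV[K]_n :=
  [set t | forall i, l 0 i <= t 0 i <= u 0 i].

(* n-dimensional Lebesgue outer measure: the infimum of the total volumes of
   the countable coverings by boxes. *)
Definition lebesgue_outer (K : realType) (n : nat) (X : set 'rV[K]_n) : \bar K :=
  ereal_inf [set s | exists l u : nat -> 'rV[K]_n,
    [/\ forall k i, l k 0 i <= u k 0 i,
        X `<=` \bigcup_k box (l k) (u k) &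
        s = (\sum_(0 <= k <oo) (\prod_(i < n) (u k 0 i - l k 0 i))%:E)%E]].

Definition affine_chart (K : realType) (d k : nat) (p : 'rV[K]_d)
    (e : k.-tuple 'rV[K]_d) (t : 'rV[K]_k) : 'rV[K]_d :=
  p + \sum_(i < k) t 0 i *: tnth e i.

(* N is null for the k-dimensional Lebesgue measure on the k-dimensional affine
   subspace C. That measure is the image of the one on R^k under an isometric
   affine chart of C; a non-isometric chart only changes it by a positive
   constant factor, so nullity may be tested in any chart. Such charts exist by
   affine_subspace_chart below. *)
Definition affine_null (K : realType) (d k : nat) (C N : set 'rV[K]_d) : Prop :=
  forall (p : 'rV[K]_d) (e : k.-tuple 'rV[K]_d),
    free e -> C = range (affine_chart p e) ->
    lebesgue_outer (affine_chart p e @^-1` N) = 0%E.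

Definition affine_ae (K : realType) (d k : nat) (C : set 'rV[K]_d)
    (P : 'rV[K]_d -> Prop) : Prop :=
  affine_null k C [set w | C w /\ ~ P w].

Definition nonincreasing_from1 (K : realType) (f : K -> K) : Prop :=
  forall x y, 1 <= x -> x <= y -> f y <= f x.

Definition mu_ (K : realType) (a b : nat) (psi : K -> K) (R : K) (T : nat) : K :=
  (T%:R / psi (R * T%:R)) ^+ (a - b).

Definition lambda_ (K : realType) (a : nat) (phi : K -> K) (R : K) (T : nat) : K :=
  (phi (R * T%:R) / T%:R) ^+ a - (phi (R * T.+1%:R) / T.+1%:R) ^+ a.

Lemma affine_subspace_chart (K : realType) (d k : nat) (C : set 'rV[K]_d) :
  affine_subspace k C ->
  exists (p : 'rV[K]_d) (e : k.-tuple 'rV[K]_d),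
    free e /\ C = range (affine_chart p e).
Proof.
move=> [p [V [<- ->]]]; exists p, (vbasis V); split.
  exact: basis_free (vbasisP V).
apply/seteqP; split => [_ [v /= Vv <-]|_ [t _ <-]].
  exists (\row_i coord (vbasis V) i v) => //.
  rewrite /affine_chart [in RHS](coord_vbasis Vv); congr (_ + _).
  by apply: eq_bigr => i _; rewrite mxE (tnth_nth 0).
exists (\sum_(i < \dim V) t 0 i *: tnth (vbasis V) i) => //=.
by apply: memv_suml => i _; rewrite memvZ// vbasis_mem// mem_tnth.
Qed.

(* Main.v *)
(* The set of points of [A] that are not [phi]-badly approximable is covered, for
   every small [eps], by balls of radius [O(eps * phi |x| / |x|)], one for each
   integer vector [x] lying within [eps * phi |x|] of the line through some
   [(1, w)], [w] in [A]. It suffices to bound the sum of [(phi |x| / |x|) ^ a]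
   over these vectors. Put [g T = T / psi T]. Modulo the directions of [B] the
   vectors lie near a space of dimension [a - b], where the bad approximability
   of [B] keeps them [psi]-separated; hence those with [g |x|] in a dyadic block
   [[G, 2 G]] are [O(G ^ (a - b))] in number, and the same bound holds for all
   those with [g |x| <= G]. As [phi <= psi], the sum is [O(sum_j 2 ^ (- j b))],
   which is finite when [b > 0]. When [b = 0] a summation by parts bounds it by
   the given series; there the vectors with [R T < |x| < R (T + 1)], which
   [mu_T] does not control through [psi], are counted separately: their number
   is [O(T ^ a)] because their scale is determined by their norm. *)
From mathcomp Require Import ring lra zify.
Require Import Defs.

Set Implicit Arguments.
Unset Strict Implicit.
Unset Printing Implicit Defensive.

Local Open Scope classical_set_scope.
Local Open Scope ring_scope.

(** * Sup-norm and bad approximability *)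

Lemma norm_coord_le (K : realType) (n : nat) (x : 'rV[K]_n) (i : 'I_n) :
  `|x 0 i| <= `|x|.
Proof.
rewrite [leRHS]/Num.norm /= mx_normrE.
by apply: (le_trans _ (le_bigmax _ _ (0, i))).
Qed.

Lemma norm_row_le (K : realType) (n : nat) (x : 'rV[K]_n) (r : K) :
  0 <= r -> (forall i, `|x 0 i| <= r) -> `|x| <= r.
Proof.
move=> r0 xr; rewrite [leLHS]/Num.norm /= mx_normrE.
by apply: bigmax_le => // -[i j] _ /=; rewrite (ord1 i).
Qed.

Lemma norm_row_mx_le (K : realType) (m n : nat) (u : 'rV[K]_m) (v : 'rV[K]_n) (r : K) :
  0 <= r -> (`|row_mx u v| <= r) = (`|u| <= r) && (`|v| <= r).
Proof.
move=> r0; apply/idP/andP => [uv|[ur vr]].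
  split; apply: norm_row_le => // i; apply: le_trans uv.
    by rewrite -(row_mxEl u v) norm_coord_le.
  by rewrite -(row_mxEr u v) norm_coord_le.
apply: norm_row_le => // i; rewrite mxE; case: (fintype.split i) => j.
  exact: le_trans (norm_coord_le u j) ur.
exact: le_trans (norm_coord_le v j) vr.
Qed.

Lemma norm_scalar1 (K : realType) (s : K) : `|s%:M : 'rV[K]_1| = `|s|.
Proof.
apply/le_anti/andP; split.
  by apply: norm_row_le => // i; rewrite mxE ord1 eqxx mulr1n.
by have := norm_coord_le (s%:M : 'rV[K]_1) 0; rewrite mxE eqxx mulr1n.
Qed.

Lemma scale_homogenize (K : realType) (d : nat) (s : K) (w : 'rV[K]_d) :
  s *: homogenize w = row_mx s%:M (s *: w).
Proof. by rewrite scale_row_mx scale_scalar_mx mulr1. Qed.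

Lemma norm_homogenize_ge1 (K : realType) (d : nat) (w : 'rV[K]_d) :
  1 <= `|homogenize w|.
Proof.
have := lexx `|homogenize w|; rewrite {1}norm_row_mx_le//.
by rewrite norm_scalar1 normr1 => /andP[].
Qed.

Lemma norm_homogenize_le (K : realType) (d : nat) (w : 'rV[K]_d) (R : K) :
  1 <= R -> `|w| <= R -> `|homogenize w| <= R.
Proof.
by move=> R1 wR; rewrite norm_row_mx_le ?wR ?norm_scalar1 ?normr1 ?R1; lra.
Qed.

Lemma homogenizeB (K : realType) (d : nat) (v w : 'rV[K]_d) :
  homogenize v - homogenize w = row_mx 0 (v - w).
Proof. by rewrite opp_row_mx add_row_mx subrr. Qed.

Lemma norm_row_mx0 (K : realType) (m n : nat) (v : 'rV[K]_n) :
  `|row_mx (0 : 'rV[K]_m) v| = `|v|.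
Proof.
apply/le_anti/andP; split; first by rewrite norm_row_mx_le// normr0 normr_ge0/=.
by have := lexx `|row_mx (0 : 'rV[K]_m) v|; rewrite {1}norm_row_mx_le// => /andP[].
Qed.

Lemma norm_homogenizeB (K : realType) (d : nat) (v w : 'rV[K]_d) :
  `|homogenize v - homogenize w| = `|v - w|.
Proof. by rewrite homogenizeB norm_row_mx0. Qed.

Lemma linear_form_bounded (K : realType) (n : nat) (f : {scalar 'rV[K]_n}) :
  exists2 C : K, 0 < C & forall v, `|f v| <= C * `|v|.
Proof.
exists (1 + \sum_(i < n) `|f (delta_mx 0 i)|).
  by rewrite ltr_pwDl// sumr_ge0.
move=> v; rewrite {1}[v]row_sum_delta linear_sum.
apply: (le_trans (ler_norm_sum _ _ _)); rewrite mulrDl mul1r.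
apply: ler_wpDl => //; rewrite mulr_suml; apply: ler_sum => i _.
by rewrite linearZ normrM mulrC ler_wpM2l// norm_coord_le.
Qed.

Lemma linear_forms_bounded (K : realType) (n m : nat)
    (f : 'I_m -> {scalar 'rV[K]_n}) :
  exists2 C : K, 0 < C & forall j v, `|f j v| <= C * `|v|.
Proof.
have /choice[C C_] j : exists C : K, 0 < C /\ forall v, `|f j v| <= C * `|v|.
  by have [C] := linear_form_bounded (f j); exists C.
exists (1 + \sum_(j < m) C j).
  by rewrite ltr_pwDl// sumr_ge0// => j _; have [/ltW] := C_ j.
move=> j v; have [_ /(_ v)/le_trans] := C_ j; apply.
rewrite ler_wpM2r//; apply: ler_wpDl => //; rewrite (bigD1 j)//= lerDl.
by rewrite sumr_ge0// => i _; have [/ltW] := C_ i.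
Qed.

Lemma norm_int_vec_ge1 (K : realType) (n : nat) (x : 'rV[int]_n) :
  x != 0 -> 1 <= `|int_vec K x|.
Proof.
move=> /rV0Pn[i xi]; apply: (le_trans _ (norm_coord_le _ i)).
by rewrite mxE -intr_norm ler1z -gtz0_ge1 normr_gt0.
Qed.

Lemma int_vecB (K : realType) (n : nat) (x y : 'rV[int]_n) :
  int_vec K (x - y) = int_vec K x - int_vec K y.
Proof. by rewrite /int_vec map_mxB. Qed.

Lemma linear_span0 (K : realType) (n : nat) (S : set 'rV[K]_n) :
  linear_span S 0.
Proof. by move=> U _; rewrite mem0v. Qed.

Lemma dist_set_le (K : realType) (n : nat) (x y : 'rV[K]_n) (S : set 'rV[K]_n) :
  S y -> dist_set x S <= `|x - y|.
Proof.
move=> Sy; apply: ge_inf; last by exists y.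
by exists 0 => _ [z _ <-].
Qed.

Lemma dist_set_ge0 (K : realType) (n : nat) (x y : 'rV[K]_n) (S : set 'rV[K]_n) :
  S y -> 0 <= dist_set x S.
Proof.
move=> Sy; apply: lb_le_inf; first by exists `|x - y|, y.
by move=> _ [z _ <-].
Qed.

Lemma dist_set_lt (K : realType) (n : nat) (x y : 'rV[K]_n) (S : set 'rV[K]_n) (e : K) :
  S y -> dist_set x S < e -> exists2 z, S z & `|x - z| < e.
Proof.
move=> Sy; rewrite -subr_gt0 => /(@inf_adherent K [set `|x - t| | t in S])[|_ [z Sz <-]].
  split; first by exists `|x - y|, y.
  by exists 0 => _ [z _ <-].
by rewrite -/(dist_set x S) [ltRHS]addrC subrK => ?; exists z.
Qed.

(** The constant [c] is the infimum of the definition itself; positivity of [psi] makes 0 a lower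
    bound of the set, so that [inf] lies below each element. *)
Lemma badly_approximable_lower_bound (K : realType) (d : nat) (psi : K -> K)
    (C : set 'rV[K]_d) :
  (forall T, 1 <= T -> 0 < psi T) -> badly_approximable psi C ->
  exists2 c : K, 0 < c & forall (x : 'rV[int]_(1 + d)) y, x != 0 ->
    linear_span (@homogenize K d @` C) y ->
    c * psi `|int_vec K x| <= `|int_vec K x - y|.
Proof.
move=> psi0; rewrite /badly_approximable; set E := [set _ | _ in _] => E0.
exists (inf E) => // x y x0 Cy; apply: le_trans (dist_set_le _ Cy).
rewrite -ler_pdivlMr ?psi0 ?norm_int_vec_ge1// mulrC.
apply: ge_inf; last by exists x.
exists 0 => _ [z z0 <-]; apply: mulr_ge0.
- by rewrite invr_ge0 ltW// psi0// norm_int_vec_ge1.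
- exact: dist_set_ge0 _ (@linear_span0 K _ _).
Qed.

(** Otherwise [e] would be a lower bound of the set in the definition, and its infimum would be
    positive. *)
Lemma not_badly_approximable_vector (K : realType) (d : nat) (phi : K -> K)
    (w : 'rV[K]_d) (e : K) :
  (forall T, 1 <= T -> 0 < phi T) -> ~ badly_approximable_vector phi w -> 0 < e ->
  exists (x : 'rV[int]_(1 + d)) (s : K), x != 0 /\
    `|int_vec K x - s *: homogenize w| < e * phi `|int_vec K x|.
Proof.
move=> phi0 nbad e0; apply: contrapT => H; apply: nbad.
apply: (lt_le_trans e0); apply: lb_le_inf.
  (* The all-ones vector shows that the set is nonempty, as [lb_le_inf] requires. *)
  exists ((phi `|int_vec K (const_mx 1 : 'rV[int]_(1 + d))|)^-1
    * dist_set (int_vec K (const_mx 1 : 'rV[int]_(1 + d)))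
               (linear_span (@homogenize K d @` [set w]))).
  exists (const_mx 1) => //=; apply/rV0Pn; exists 0; by rewrite mxE.
move=> _ [x /= x0 <-]; have p0 := phi0 _ (norm_int_vec_ge1 K x0).
rewrite mulrC ler_pdivlMr// leNgt; apply/negP => lt.
have [z] := dist_set_lt (@linear_span0 K _ _) lt.
(* The line through [homogenize w] is one of the subspaces intersected in [linear_span]. *)
move=> /(_ <[homogenize w]>%VS) Sz zlt; have /vlineP[s zE] : z \in <[homogenize w]>%VS.
  apply: Sz => _ [v -> <-]; exact: memv_line.
by apply: H; exists x, s; rewrite -zE.
Qed.

(** * Counting in grids and covering by balls *)

Lemma size_le_card_codomain (T : eqType) (F : finType) (f : T -> F) (L : seq T) :
  uniq L -> {in L &, injective f} -> (size L <= #|F|)%N.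
Proof.
move=> uL injf; rewrite -(size_map f) -(card_uniqP _) ?max_card//.
by rewrite map_inj_in_uniq.
Qed.

(** Pigeonhole: an element is sent to its tag and the integer parts of its coordinates. Two elements
    with the same image have coordinates differing by less than 1, hence coincide. *)
Lemma grid_count (K : realType) (T : eqType) (F : finType) (n : nat) (tag : T -> F)
    (c : T -> 'I_n -> K) (Q : K) (L : seq T) :
  uniq L -> 0 <= Q -> {in L, forall x j, `|c x j| <= Q} ->
  {in L &, forall x y, tag x = tag y -> (forall j, `|c x j - c y j| < 1) -> x = y} ->
  (size L)%:R <= #|F|%:R * (2 * Q + 3) ^+ n.
Proof.
move=> uL Q0 cQ sep; set N := (Num.truncn Q).+1.
(* Adding [N] makes the integer parts nonnegative, and [2 * N + 1 <= 2 * Q + 3]. *)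
pose f x := (tag x, [ffun j => inord (absz (Num.floor (c x j) + N%:Z))]
             : {ffun 'I_n -> 'I_(2 * N).+1}).
have NQ : Q < N%:R by rewrite truncnS_gt.
have fl x j : x \in L -> 0 <= Num.floor (c x j) + N%:Z < (2 * N)%:Z.
  move=> /cQ/(_ j); rewrite ler_norml => /andP[lo hi].
  have /andP[h1 h2] := floor_itv (c x j).
  apply/andP; split.
    rewrite -ltzD1 -(ltr_int K) !intrD.
    rewrite intrD in h2; rewrite -pmulrn; lra.
  rewrite -(ltr_int K) intrD -!pmulrn natrM; lra.
have injf : {in L &, injective f}.
  move=> x y xL yL [] txy /ffunP ffxy; apply: sep => // j.
  have := ffxy j; rewrite !ffunE => /(congr1 val).
  have /andP[x0 xN] := fl x j xL; have /andP[y0 yN] := fl y j yL.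
  rewrite /= !inordK; [|lia|lia] => e.
  have {}e : Num.floor (c x j) = Num.floor (c y j) by lia.
  have /andP[h1 h2] := floor_itv (c x j).
  have := floor_itv (c y j); rewrite -e => /andP[h3 h4].
  rewrite intrD in h2; rewrite intrD in h4.
  rewrite ltr_norml; apply/andP; split; lra.
have := size_le_card_codomain uL injf; rewrite card_prod card_ffun !card_ord.
rewrite -(ler_nat K) natrM natrX => /le_trans; apply.
rewrite ler_wpM2l// lerXn2r ?nnegrE//; first lra.
have /andP[Q1 _] := truncn_itv Q0.
by rewrite /N -natr1 natrM -natr1; lra.
Qed.

Lemma lebesgue_outer_ge0 (K : realType) (n : nat) (X : set 'rV[K]_n) :
  (0 <= lebesgue_outer X)%E.
Proof.
apply/ereal_infP => _ [l [u [lu _ ->]]].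
apply: nneseries_ge0 => k _ _; rewrite lee_fin prodr_ge0// => i _.
by rewrite subr_ge0.
Qed.

(** A ball for the sup-norm is a box of volume [(2 * h x) ^+ n]. Each partial sum of the volumes
    runs over a finite list without repetition, to which the bound [S] applies. *)
Lemma lebesgue_outer_le_sum_balls (K : realType) (T : countType) (n : nat) (D : set T)
    (c : T -> 'rV[K]_n) (h : T -> K) (S : K) (X : set 'rV[K]_n) :
  (0 < n)%N -> (forall x, 0 <= h x) ->
  (forall L : seq T, uniq L -> {in L, forall x, D x} -> \sum_(x <- L) h x ^+ n <= S) ->
  X `<=` \bigcup_(x in D) [set t | `|t - c x| <= h x] ->
  (lebesgue_outer X <= (2 ^+ n * S)%:E)%E.
Proof.
move=> n0 h0 hS XD.
(* An index that codes no element of [D] gets the box reduced to the origin, of volume 0 because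
   [0 < n]. *)
pose l k : 'rV[K]_n := if pickle_inv k is Some x then
  (if `[<D x>] then c x - const_mx (h x) else 0) else 0.
pose u k : 'rV[K]_n := if pickle_inv k is Some x then
  (if `[<D x>] then c x + const_mx (h x) else 0) else 0.
have lu k i : l k 0 i <= u k 0 i.
  rewrite /l /u; case: pickle_inv => [x|]; last by rewrite mxE.
  case: ifP; rewrite !mxE => // _; have := h0 x; lra.
have volE k : \prod_(i < n) (u k 0 i - l k 0 i) =
    oapp (fun x => if `[<D x>] then (2 * h x) ^+ n else 0) 0 (pickle_inv k : option T).
  rewrite /l /u; case: pickle_inv => [x|] /=; last first.
    by rewrite (eq_bigr (fun=> 0)) ?prodr_const ?card_ord ?expr0n ?gtn_eqF// => i _;
      rewrite mxE subrr.
  case: ifP => _.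
    rewrite (eq_bigr (fun=> 2 * h x)) ?prodr_const ?card_ord// => i _.
    by rewrite !mxE; ring.
  by rewrite (eq_bigr (fun=> 0)) ?prodr_const ?card_ord ?expr0n ?gtn_eqF// => i _;
    rewrite mxE subrr.
apply: (@le_trans _ _ (\sum_(0 <= k <oo) (\prod_(i < n) (u k 0 i - l k 0 i))%:E)%E).
  apply: ereal_inf_lbound; exists l, u; split => // t /XD[x Dx tx].
  exists (pickle x) => // i; rewrite /l /u pickleK_inv asboolT// !mxE.
  have := le_trans (norm_coord_le (t - c x) i) tx.
  by rewrite !mxE ler_norml => /andP[? ?]; apply/andP; split; lra.
apply: lime_le.
  apply: is_cvg_nneseries => k _ _; rewrite lee_fin prodr_ge0// => i _.
  by rewrite subr_ge0.
near=> N; rewrite sumEFin lee_fin (eq_bigr _ (fun k _ => volE k)).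
rewrite /index_iota subn0 -big_pmap.
rewrite -big_mkcond /= -big_filter.
rewrite (eq_bigr (fun x => 2 ^+ n * h x ^+ n)); last by move=> x _; rewrite exprMn.
rewrite -mulr_sumr ler_wpM2l// ?exprn_ge0// hS//.
  by rewrite filter_uniq// (pmap_uniq pickle_invK)// iota_uniq.
by move=> x; rewrite mem_filter => /andP[/asboolP].
Unshelve. all: end_near.
Qed.

(** * Integer approximants of the points of an affine subspace *)

(** The [f j] form a basis of a complement of [W] in [V], and the [l j] are the coordinates in it of
    the projection along [W]. *)
Lemma quotient_coordinates (K : realType) (d : nat) (V W : {vspace 'rV[K]_d}) :
  (W <= V)%VS ->
  exists (f : 'I_(\dim V - \dim W) -> 'rV[K]_d)
         (l : 'I_(\dim V - \dim W) -> {scalar 'rV[K]_d}),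
    forall v, v \in V -> v - \sum_j l j v *: f j \in W.
Proof.
move=> WV; have <- : \dim (V :\: W) = (\dim V - \dim W)%N.
  by rewrite -(dimv_cap_compl V W) (capv_idPr WV) addKn.
pose X := vbasis (V :\: W).
exists (fun j => X`_j), (fun j => (coord X j \o addv_pi1 V W : 'rV[K]_d -> K)).
move=> v vV /=.
have vVW : v \in (V + W)%VS by rewrite (addv_idPl WV).
have pD : addv_pi1 V W v \in (V :\: W)%VS by exact: memv_pi.
by rewrite -(coord_vbasis pD) -{1}(addv_pi1_pi2 vVW) addrC addKr memv_pi2.
Qed.

Lemma linear_span_homogenize (K : realType) (d : nat) (q v : 'rV[K]_d)
    (W : {vspace 'rV[K]_d}) (t : K) :
  v \in W ->
  linear_span (@homogenize K d @` [set q + u | u in [set u | u \in W]])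
    (t *: homogenize q + row_mx 0 v).
Proof.
move=> vW U hU.
have hq u : u \in W -> homogenize (q + u) \in U.
  by move=> uW; apply: hU; exists (q + u) => //; exists u.
have Uq : homogenize q \in U by rewrite -[q]addr0 hq// mem0v.
rewrite memvD ?memvZ// -[v](addKr q) addrC -homogenizeB.
by rewrite memvB// hq.
Qed.

Definition approximates (K : realType) (d : nat) (A : set 'rV[K]_d) (R : K)
    (eta : K -> K) (x : 'rV[int]_(1 + d)) (w : 'rV[K]_d) (s : K) : Prop :=
  [/\ x != 0, A w, `|w| <= R &
      `|int_vec K x - s *: homogenize w| <= eta `|int_vec K x|].

Definition approximant (K : realType) (d : nat) (A : set 'rV[K]_d) (R : K)
    (eta : K -> K) : set 'rV[int]_(1 + d) :=
  [set x | exists w s, approximates A R eta x w s].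

(** The norm of [s *: homogenize w] lies between [|s|] and [R * |s|], and a tolerance of at most 1/2
    is at most half of [|x|]. *)
Lemma approximates_scale (K : realType) (d : nat) (A : set 'rV[K]_d) (R : K)
    (eta : K -> K) (x : 'rV[int]_(1 + d)) (w : 'rV[K]_d) (s : K) :
  1 <= R -> eta `|int_vec K x| <= 2^-1 -> approximates A R eta x w s ->
  `|int_vec K x| <= 2 * R * `|s| /\ `|s| <= 2 * `|int_vec K x|.
Proof.
move=> R1 eta2 [x0 Aw wR xs]; have nx := norm_int_vec_ge1 K x0.
have h1 := norm_homogenize_ge1 w; have hR := norm_homogenize_le R1 wR.
have := ler_dist_dist (int_vec K x) (s *: homogenize w).
have s0 := normr_ge0 s.
have : `|s| <= `|s| * `|homogenize w| by rewrite ler_peMr.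
have : `|s| * `|homogenize w| <= `|s| * R by rewrite ler_wpM2l.
rewrite normrZ; set p := `|s| * _; set m := `|int_vec K x| in nx xs eta2 *.
move=> sp ps; rewrite ler_norml => /andP[? ?].
have e1 : 2 * R * `|s| = 2 * (`|s| * R) by ring.
rewrite e1; lra.
Qed.

(** This fixes the radius of the covering balls. Comparing both multiples with [x] bounds [|s - s'|]
    and [|s w - s' w'|] by twice the tolerance; hence [|s| * |w - w'|] is at most [2 * (1 + R)]
    times the tolerance, while [|s|] is at least [|x| / (2 * R)]. *)
Lemma approximates_close (K : realType) (d : nat) (A : set 'rV[K]_d) (R : K)
    (eta : K -> K) (x : 'rV[int]_(1 + d)) (w w' : 'rV[K]_d) (s s' : K) :
  1 <= R -> eta `|int_vec K x| <= 2^-1 ->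
  approximates A R eta x w s -> approximates A R eta x w' s' ->
  `|w - w'| <= 4 * R * (1 + R) * (eta `|int_vec K x| / `|int_vec K x|).
Proof.
move=> R1 eta2 xw xw'; have [xs _] := approximates_scale R1 eta2 xw.
have [x0 _ wR xsw] := xw; have [_ _ wR' xsw'] := xw'.
have nx := norm_int_vec_ge1 K x0.
set m := `|int_vec K x| in nx xs xsw xsw' eta2 *; set e := eta m in eta2 xsw xsw' *.
have e0 : 0 <= e := le_trans (normr_ge0 _) xsw.
have : `|row_mx (s - s')%:M (s *: w - s' *: w')| <= 2 * e.
  have -> : row_mx (s - s')%:M (s *: w - s' *: w') =
            s *: homogenize w - s' *: homogenize w' :> 'rV[K]_(1 + d).
    by rewrite !scale_homogenize opp_row_mx add_row_mx raddfB.
  rewrite -(subrKA (int_vec K x)); apply: le_trans (ler_normD _ _) _.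
  by rewrite distrC mulr2n mulrDl !mul1r lerD.
rewrite norm_row_mx_le; last lra.
rewrite norm_scalar1 => /andP[ss sw].
have key : `|s| * `|w - w'| <= 2 * e * (1 + R).
  rewrite -normrZ.
  have -> : s *: (w - w') = (s *: w - s' *: w') + (s' - s) *: w'.
    by rewrite scalerBr scalerBl addrA subrK.
  apply: le_trans (ler_normD _ _) _; rewrite normrZ [`|s' - s|]distrC mulrDr mulr1 lerD//.
  exact: ler_pM.
rewrite mulrA ler_pdivlMr; last lra.
have -> : 4 * R * (1 + R) * e = 2 * R * (2 * e * (1 + R)) by ring.
apply: le_trans (ler_wpM2l (normr_ge0 _) xs) _.
rewrite mulrCA [_ * `|s|]mulrC ler_wpM2l//; lra.
Qed.

Lemma affine_subset_direction (K : realType) (d : nat) (p q : 'rV[K]_d)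
    (V W : {vspace 'rV[K]_d}) :
  [set q + v | v in [set v | v \in W]] `<=` [set p + v | v in [set v | v \in V]] ->
  (W <= V)%VS /\ forall w, [set p + v | v in [set v | v \in V]] w -> w - q \in V.
Proof.
move=> WV.
have [v0 /= v0V qE] : [set p + v | v in [set v | v \in V]] q.
  by apply: WV; exists 0; rewrite /= ?mem0v// addr0.
split; last first.
  by move=> _ [v /= vV <-]; rewrite -qE opprD addrACA subrr add0r memvB.
apply/subvP => w wW; have [v /= vV] : [set p + v | v in [set v | v \in V]] (q + w).
  by apply: WV; exists w.
rewrite -qE -addrA => /addrI e.
have -> : w = v - v0 by rewrite e addrAC subrr add0r.
by rewrite memvB.
Qed.

Lemma norm_lincomb_le (K : realType) (d n : nat) (u : 'I_n -> K) (f : 'I_n -> 'rV[K]_d)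
    (r : K) :
  (forall j, `|u j| <= r) -> `|\sum_j u j *: f j| <= r * \sum_j `|f j|.
Proof.
move=> ur; apply: le_trans (ler_norm_sum _ _ _) _.
by rewrite mulr_sumr ler_sum// => j _; rewrite normrZ ler_wpM2r.
Qed.

(** The bound [M], rather than [2 * M], matters: monotonicity gives [psi M <= psi |x - y|], whereas
    [psi (2 * M)] could be far smaller than [psi M]. *)
Lemma norm_same_sign_sub (K : realType) (n : nat) (x y : 'rV[int]_n) (M : K) :
  (forall i, (0 <= x 0 i) = (0 <= y 0 i)) -> `|int_vec K x| <= M -> `|int_vec K y| <= M ->
  `|int_vec K (x - y)| <= M.
Proof.
move=> sgn xM yM; apply: norm_row_le => [|i]; first exact: le_trans xM.
have := le_trans (norm_coord_le _ i) xM; have := le_trans (norm_coord_le _ i) yM.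
rewrite !mxE rmorphB /= !ler_norml => /andP[? ?] /andP[? ?].
have := sgn i; case: (leP 0 (x 0 i)) => x0 /esym; [|move/negbT; rewrite -ltNge].
  move: x0; rewrite -!(ler_int K) => ? ?; apply/andP; split; lra.
move: x0; rewrite -!(ltr_int K) => ? ?; apply/andP; split; lra.
Qed.

Lemma approximants_choice (K : realType) (d : nat) (A : set 'rV[K]_d) (R : K)
    (eta : K -> K) :
  exists (w : 'rV[int]_(1 + d) -> 'rV[K]_d) (s : 'rV[int]_(1 + d) -> K),
  forall x, approximant A R eta x -> approximates A R eta x (w x) (s x).
Proof.
have /choice[ws wsP] (x : 'rV[int]_(1 + d)) : exists ws : 'rV[K]_d * K,
    approximant A R eta x -> approximates A R eta x ws.1 ws.2.
  have [[w [s xws]]|nx] := pselect (approximant A R eta x); first by exists (w, s).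
  by exists (0, 0).
by exists (fun x => (ws x).1), (fun x => (ws x).2).
Qed.

(* Modulo the directions of [B], approximants lie near a space of dimension
   [a - b] and are separated by the bad approximability of [B]; as [psi] varies
   by a factor at most 2 along [L], the separation beats the distance to [A]. *)
Lemma approximants_block_count (K : realType) (d a b : nat) (R : K)
    (A B : set 'rV[K]_d) (psi : K -> K) :
  1 <= R -> B `<=` A -> affine_subspace b B -> affine_subspace a A ->
  (forall T, 1 <= T -> 0 < psi T) -> nonincreasing_from1 psi ->
  badly_approximable psi B ->
  exists e C : K, [/\ 0 < e, 0 < C & forall (L : seq 'rV[int]_(1 + d)) (M : K),
    uniq L -> 1 <= M -> {in L, forall x, approximant A R (fun T => e * psi T) x} ->
    {in L, forall x, `|int_vec K x| <= M} ->
    {in L, forall x, M / psi M <= 2 * (`|int_vec K x| / psi `|int_vec K x|)} ->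
    (size L)%:R <= C * (M / psi M) ^+ (a - b)].
Proof.
move=> R1 BA [q [W [dimW BE]]] [p [V [dimV AE]]] psi0 psi_mono bad.
have [c c0 badc] := badly_approximable_lower_bound psi0 bad.
rewrite BE AE in BA; have [WV Aq] := affine_subset_direction BA.
have [f [l flP]] := quotient_coordinates WV.
rewrite dimW dimV in f l flP.
have [Cl Cl0 ClP] := linear_forms_bounded l.
set F := \sum_j `|f j|; have F0 : 0 <= F by rewrite sumr_ge0.
have psi1 : 0 < psi 1 by rewrite psi0.
(* The first bound makes the tolerances small against the separation; the second keeps [e * psi T]
   at most 1/2, as [approximates_scale] requires. *)
pose e := Num.min (c / 16) (2 * psi 1)^-1.
have e0 : 0 < e by rewrite lt_min divr_gt0// invr_gt0 mulr_gt0.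
have ec : e <= c / 16 by rewrite ge_min lexx.
have e2 T : 1 <= T -> e * psi T <= 2^-1.
  move=> T1; apply: (@le_trans _ _ ((2 * psi 1)^-1 * psi 1)).
    by rewrite ler_pM ?psi_mono// ?ge_min ?lexx ?orbT// ltW// psi0.
  by rewrite invfM -mulrA mulVf ?mulr1// gt_eqF.
pose C' := Cl * (2 * (R + `|q|)) * (4 * (F + 1)) / c.
have C'0 : 0 <= C'.
  have := normr_ge0 q => q0; rewrite /C' !mulr_ge0 ?invr_ge0//; lra.
pose C := 2 ^+ (1 + d) * (2 * C' + 3 * psi 1) ^+ (a - b).
exists e, C; split => //.
  rewrite mulr_gt0 ?exprn_gt0//; lra.
move=> L M uL M1 Lapp LM Lg.
have [w [s wsP]] := approximants_choice A R (fun T => e * psi T).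
have {}wsP x (xL : x \in L) := wsP x (Lapp x xL).
have psiM := psi0 M M1.
(* Quotient coordinates that differ by less than [delta] give a vector of norm at most
   [c * psi M / 4]; [F + 1] avoids a zero denominator. *)
pose delta := c * psi M / (4 * (F + 1)).
have delta0 : 0 < delta by rewrite divr_gt0 ?mulr_gt0//; lra.
have psi2 x : x \in L -> psi `|int_vec K x| <= 2 * psi M.
  move=> xL; have [x0 _ _ _] := wsP x xL; have nx := norm_int_vec_ge1 K x0.
  have := Lg x xL; have := psi0 _ nx; have := LM x xL.
  set m := `|int_vec K x| in nx *; set g := psi m => mM g0.
  rewrite ler_pdivrMr// mulrA mulrAC ler_pdivlMr//.
  have : m * psi M <= M * psi M by rewrite ler_wpM2r// ltW.
  move=> h1 h2; have h3 : M * g <= M * (2 * psi M) by lra.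
  by rewrite ler_pM2l in h3; lra.
pose y j x := l j (s x *: (w x - q)).
have yB x j : x \in L -> `|y j x| <= Cl * (2 * (R + `|q|)) * M.
  move=> xL; apply: le_trans (ClP _ _) _; rewrite -mulrA ler_pM2l// normrZ.
  have [x0 _ wR _] := wsP x xL; have nx := norm_int_vec_ge1 K x0.
  have [_ sx] := approximates_scale R1 (e2 _ nx) (wsP x xL).
  have := ler_normB (w x) q => wq.
  have -> : 2 * (R + `|q|) * M = 2 * M * (R + `|q|) by ring.
  apply: ler_pM => //; last lra.
  by apply: le_trans sx _; have := LM x xL; lra.
have Qe : Cl * (2 * (R + `|q|)) * M / delta = C' * (M / psi M).
  rewrite /C' /delta; field.
  by rewrite !gt_eqF//; lra.
have Q0 : 0 <= Cl * (2 * (R + `|q|)) * M / delta.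
  by rewrite Qe mulr_ge0// divr_ge0// ltW//; lra.
(* The tag is the sign pattern, for use in [norm_same_sign_sub]. *)
have := @grid_count K _ {ffun 'I_(1 + d) -> bool} (a - b)
  (fun x : 'rV[int]_(1 + d) => [ffun i => 0 <= x 0 i]) (fun x j => y j x / delta)
  (Cl * (2 * (R + `|q|)) * M / delta) L uL Q0.
rewrite Qe card_ffun card_bool card_ord => H; apply: le_trans (H _ _) _.
- move=> x xL j; rewrite normrM normfV (gtr0_norm delta0) -Qe.
  by rewrite ler_pM2r ?invr_gt0// yB.
- move=> x x' xL xL' /ffunP sgn clo; apply: contrapT => /eqP xx'.
  have sgn' i : (0 <= x 0 i) = (0 <= x' 0 i) by have := sgn i; rewrite !ffunE.
  have xx0 : x - x' != 0 by rewrite subr_eq0.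
  have nxx := norm_int_vec_ge1 K xx0.
  have nxM := norm_same_sign_sub sgn' (LM x xL) (LM x' xL').
  have [x0 Ax wR xs] := wsP x xL; have [x'0 Ax' wR' xs'] := wsP x' xL'.
  rewrite AE in Ax Ax'.
  pose v := s x *: (w x - q) - s x' *: (w x' - q).
  have vV : v \in V by rewrite memvB// memvZ// Aq.
  (* Removing from the difference of the two multiples its component along the [f j] leaves a point
     of the span of [B]. Its distance to [x - x'] is at most [c * psi M / 8] for each tolerance plus
     [c * psi M / 4] for that component, which is less than [c * psi M]. *)
  have := badc _ _ xx0; rewrite BE.
  move=> /(_ _ (@linear_span_homogenize K d q _ W (s x - s x') (flP v vV))).
  apply/negP; rewrite -ltNge.
  have -> : int_vec K (x - x') - ((s x - s x') *: homogenize q + row_mx 0 (v - \sum_j l j v *: f j))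
     = (int_vec K x - s x *: homogenize (w x)) - (int_vec K x' - s x' *: homogenize (w x'))
       + row_mx 0 (\sum_j l j v *: f j).
    have hE z : s z *: homogenize (w z) = s z *: homogenize q + row_mx 0 (s z *: (w z - q)).
      by rewrite scalerBr !scale_homogenize add_row_mx addr0 addrC subrK.
    have -> : row_mx 0 (v - \sum_j l j v *: f j) = row_mx 0 (s x *: (w x - q))
        - row_mx 0 (s x' *: (w x' - q)) - row_mx 0 (\sum_j l j v *: f j) :> 'rV[K]_(1 + d).
      by rewrite !opp_row_mx !add_row_mx oppr0 !addr0.
    rewrite int_vecB !hE.
    set P := row_mx _ (s x *: _); set P' := row_mx _ (s x' *: _); set S := row_mx _ (\sum_j _).
    clearbody P P' S.
    by apply/rowP => i; rewrite !mxE; ring.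
  have vd : `|row_mx (0 : 'rV[K]_1) (\sum_j l j v *: f j)| <= delta * F.
    rewrite norm_row_mx0; apply: norm_lincomb_le => j.
    have := clo j; rewrite -mulrBl normrM normfV (gtr0_norm delta0) ltr_pdivrMr// mul1r.
    by rewrite /v linearB => /ltW.
  apply: le_lt_trans (ler_normD _ _) _.
  apply: le_lt_trans (lerD (ler_normB _ _) (lexx _)) _.
  have dF : delta * F <= c * psi M / 4.
    rewrite /delta invfM mulrA -[leLHS]mulrA ler_piMr//; first by rewrite divr_ge0// mulr_ge0// ltW.
    by rewrite mulrC ler_pdivrMr; lra.
  have cp : c * psi M <= c * psi `|int_vec K (x - x')| by rewrite ler_pM2l// psi_mono.
  have ep z : z \in L -> e * psi `|int_vec K z| <= c * psi M / 8.
    move=> zL; have := psi2 z zL => pz.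
    apply: le_trans (ler_wpM2l (ltW e0) pz) _.
    have := ler_wpM2r (ltW psiM) ec; lra.
  have := ep x xL; have := ep x' xL'.
  have : 0 < c * psi M by rewrite mulr_gt0.
  lra.
- rewrite /C natrX -mulrA ler_pM2l ?exprn_gt0// -exprMn.
  (* The additive constant 3 is absorbed, since [psi 1 * (M / psi M)] is at least 1. *)
  have g1 : (psi 1)^-1 <= M / psi M.
    rewrite ler_pdivlMr// mulrC ler_pdivrMr//.
    by apply: le_trans (psi_mono _ _ (lexx 1) M1) _; rewrite ler_peMl// ltW.
  have g0 : 0 <= M / psi M by apply: le_trans g1; rewrite invr_ge0 ltW.
  have : 1 <= psi 1 * (M / psi M) by rewrite -ler_pdivrMl// mulr1.
  move: g0; set G := M / psi M => g0 g3; have CG := mulr_ge0 C'0 g0.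
  have hle : 2 * (C' * G) + 3 <= (2 * C' + 3 * psi 1) * G.
    have -> : (2 * C' + 3 * psi 1) * G = 2 * (C' * G) + 3 * (psi 1 * G) by ring.
    by rewrite lerD2l ler_peMr.
  by rewrite lerXn2r ?nnegrE//; lra.
Qed.

Lemma affine_chartB (K : realType) (d k : nat) (p : 'rV[K]_d) (e : k.-tuple 'rV[K]_d)
    (t u : 'rV[K]_k) :
  affine_chart p e t - affine_chart p e u = \sum_(i < k) (t 0 i - u 0 i) *: tnth e i.
Proof.
rewrite /affine_chart opprD addrACA subrr add0r -sumrB.
by apply: eq_bigr => i _; rewrite scalerBl.
Qed.

(** Coordinates in a free family are linear forms, hence bounded. Small sets of [A] thus have small
    preimages in the chart. *)
Lemma affine_chart_expanding (K : realType) (d k : nat) (p : 'rV[K]_d)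
    (e : k.-tuple 'rV[K]_d) : free e ->
  exists2 C : K, 0 < C & forall t u,
    `|t - u| <= C * `|affine_chart p e t - affine_chart p e u|.
Proof.
move=> fe.
have [C C0 CP] := linear_forms_bounded (fun j => coord e j : {scalar 'rV[K]_d}).
exists C => // t u; apply: norm_row_le; first by rewrite mulr_ge0// ltW.
move=> i; apply: le_trans (CP i _); rewrite affine_chartB.
rewrite (eq_bigr (fun j => (t 0 j - u 0 j) *: e`_j)) => [|j _]; last by rewrite (tnth_nth 0).
by rewrite /= (coord_sum_free (fun j => t 0 j - u 0 j) i fe) !mxE.
Qed.

Lemma norm_int_vec_nat (K : realType) (n : nat) (x : 'rV[int]_n) :
  `|int_vec K x| \is a Num.nat.
Proof.
rewrite /Num.norm /=.
have [->|/mx_norm_neq0[i ->]] := eqVneq (mx_norm (int_vec K x)) 0.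
  by rewrite rpred0.
by rewrite mxE natr_norm_int// intr_int.
Qed.

Lemma inord_sub_inj (N k k' n : nat) :
  (N <= k < N + n.+1)%N -> (N <= k' < N + n.+1)%N ->
  inord (k - N) = inord (k' - N) :> 'I_n.+1 -> k = k'.
Proof.
move=> kN k'N /(congr1 val); rewrite /= !inordK; lia.
Qed.

(* On [L] the scale [s] of an approximant is determined, up to a bounded error,
   by the point [w] of [A] and by its norm, so that only the [a] coordinates of
   [w] remain free. *)
Lemma approximants_shell_count (K : realType) (d a : nat) (R : K)
    (p : 'rV[K]_d) (e : a.-tuple 'rV[K]_d) :
  1 <= R -> free e ->
  exists h C : K, [/\ 0 < h, 0 < C &
    forall (eta : K -> K) (L : seq 'rV[int]_(1 + d)) (M : K),
    (forall T, 1 <= T -> eta T <= h) ->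
    uniq L -> 1 <= M ->
    {in L, forall x, approximant (range (affine_chart p e)) R eta x} ->
    {in L, forall x, M <= `|int_vec K x| <= M + R} ->
    (size L)%:R <= C * M ^+ a].
Proof.
move=> R1 fe; have [Cc Cc0 CcP] := affine_chart_expanding p fe.
set F := \sum_i `|tnth e i|; have F0 : 0 <= F by rewrite sumr_ge0.
(* [h] and [delta] are chosen so that [(1 + R) * h] and [(1 + R) * (m * rho)] below are at most 1/8;
   the errors that make up [x - x'] then total at most 1/2. *)
pose h : K := (8 * (1 + R))^-1.
have h0 : 0 < h by rewrite invr_gt0 mulr_gt0//; lra.
have h2 : h <= 2^-1 by rewrite lef_pV2 ?posrE ?mulr_gt0//; lra.
pose delta := (8 * (1 + R) ^+ 2 * (F + 1))^-1.
have delta0 : 0 < delta by rewrite invr_gt0 !mulr_gt0// ?exprn_gt0//; lra.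
pose Q0 := Cc * (R + `|p|) / delta.
have Q00 : 0 <= Q0 by rewrite divr_ge0 ?mulr_ge0 ?addr_ge0// ltW//; lra.
pose C := (2 * (Num.truncn R).+2)%:R * (2 * Q0 + 3) ^+ a.
exists h, C; split => //.
  by rewrite mulr_gt0 ?exprn_gt0 ?ltr0n//; lra.
move=> eta L M etah uL M1 Lapp LM.
have [w [s wsP]] := approximants_choice (range (affine_chart p e)) R eta.
have {}wsP x (xL : x \in L) := wsP x (Lapp x xL).
have /choice[t tP] x : exists t : 'rV[K]_a, x \in L -> w x = affine_chart p e t.
  have [xL|] := boolP (x \in L); last by exists 0.
  by have [_ [t _ wE] _ _] := wsP x xL; exists t.
have Q0M : 0 <= Q0 * M by rewrite mulr_ge0//; lra.
have trM x : x \in L ->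
    (Num.truncn M <= Num.truncn `|int_vec K x| < Num.truncn M + (Num.truncn R).+2)%N.
  move=> /LM/andP[Mx xM]; rewrite le_truncn//=.
  have M0 : 0 <= M by lra. have R0 : 0 <= R by lra.
  have /andP[_ ltM] := truncn_itv M0; have /andP[_ ltR] := truncn_itv R0.
  rewrite truncn_lt_nat// natrD -!natr1 in ltM ltR *; lra.
(* The tag records the sign of [s] and the norm of [x], an integer with at most [truncn R + 2]
   values in the shell. The coordinates of [w] in the chart are taken at mesh [delta / M]. *)
have := @grid_count K _ (bool * 'I_(Num.truncn R).+2)%type a
  (fun x : 'rV[int]_(1 + d) => (0 <= s x, inord (Num.truncn `|int_vec K x| - Num.truncn M)))
  (fun x j => t x 0 j * M / delta) (Q0 * M) L uL Q0M.
rewrite card_prod card_bool card_ord => H; apply: le_trans (H _ _) _.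
- move=> x xL j; have [_ _ wR _] := wsP x xL.
  rewrite 2!normrM normfV (gtr0_norm delta0) (ger0_norm (_ : 0 <= M)); last lra.
  have di : 0 < delta^-1 by rewrite invr_gt0.
  rewrite /Q0 [leRHS]mulrAC (ler_pM2r di) (ler_pM2r (_ : 0 < M)); last lra.
  have := le_trans (norm_coord_le (t x - 0) j) (CcP (t x) 0).
  rewrite subr0 => /le_trans; apply; rewrite ler_pM2l// -tP//.
  have -> : affine_chart p e 0 = p.
    by rewrite /affine_chart big1 ?addr0// => i _; rewrite mxE scale0r.
  by have := ler_normB (w x) p; lra.
- move=> x x' xL xL' [sgn nE] clo.
  have [x0 _ wR xs] := wsP x xL; have [x'0 _ wR' xs'] := wsP x' xL'.
  have nx := norm_int_vec_ge1 K x0; have nx' := norm_int_vec_ge1 K x'0.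
  have mE : `|int_vec K x'| = `|int_vec K x|.
    rewrite -[LHS]truncnK ?norm_int_vec_nat// -[RHS]truncnK ?norm_int_vec_nat//.
    by rewrite (inord_sub_inj (trM x xL) (trM x' xL') nE).
  have [_ sx'] := approximates_scale R1 (le_trans (etah _ nx') h2) (wsP x' xL').
  have {}xs := le_trans xs (etah _ nx); have {}xs' := le_trans xs' (etah _ nx').
  have /andP[_ xM] := LM x xL; rewrite mE in sx'.
  set m := `|int_vec K x| in nx mE sx' xM.
  have ww : M * `|w x - w x'| <= F * delta.
    rewrite (tP _ xL) (tP _ xL') affine_chartB.
    have -> : F * delta = M * (delta / M * F) by field; rewrite gt_eqF//; lra.
    rewrite ler_pM2l; last lra.
    apply: norm_lincomb_le => j; have := clo j.
    rewrite -!mulrBl 2!normrM normfV (gtr0_norm delta0) (ger0_norm (_ : 0 <= M)); last lra.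
    rewrite ltr_pdivrMr// mul1r => /ltW.
    by rewrite ler_pdivlMr//; lra.
  set rho := `|w x - w x'| in ww; have rho0 : 0 <= rho by exact: normr_ge0.
  have mrho : m * rho <= (1 + R) * (F * delta).
    apply: (@le_trans _ _ ((1 + R) * M * rho)); last by rewrite -mulrA ler_wpM2l//; lra.
    rewrite ler_wpM2r//; have : R <= R * M by rewrite ler_peMr//; lra.
    lra.
  have hw := norm_homogenize_ge1 (w x); have hR := norm_homogenize_le R1 wR.
  have hh : `|homogenize (w x) - homogenize (w x')| = rho by rewrite norm_homogenizeB.
  have sr : `|s x'| * rho <= 2 * (m * rho) by rewrite mulrA ler_wpM2r.
  (* The signs agree, so [|s|] and [|s'|] may be compared: their products with the norms of the
     homogenized points are both within [h] of the common norm [m]. *)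
  have ss : `|s x - s x'| <= 2 * h + 2 * (m * rho).
    have -> : `|s x - s x'| = `| `|s x| - `|s x'| |.
      move: sgn; case: (leP 0 (s x)) => s0 /esym.
        by move=> s0'; rewrite (ger0_norm s0) (ger0_norm s0').
      move=> /negbT; rewrite -ltNge => s0'; rewrite (ltr0_norm s0) (ltr0_norm s0').
      by rewrite -opprD normrN.
    apply: (@le_trans _ _ (`| `|s x| - `|s x'| | * `|homogenize (w x)|)).
      by rewrite ler_peMr.
    have := le_trans (ler_dist_dist _ _) xs; rewrite normrZ -/m => i1.
    have := le_trans (ler_dist_dist _ _) xs'; rewrite normrZ mE => i2.
    have := ler_dist_dist (homogenize (w x)) (homogenize (w x')); rewrite hh => i3.
    have i4 : `| `|s x'| * (`|homogenize (w x)| - `|homogenize (w x')|)| <= 2 * (m * rho).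
      by rewrite normrM normr_id; apply: le_trans sr; rewrite ler_wpM2l.
    rewrite -[X in _ * X <= _]normr_id -normrM mulrBl.
    move: i1 i2 i4; rewrite mulrBr !ler_norml.
    move=> /andP[? ?] /andP[? ?] /andP[? ?]; apply/andP; split; lra.
  apply: contrapT => /eqP; rewrite -subr_eq0 => xx0.
  have := norm_int_vec_ge1 K xx0; apply/negP; rewrite -ltNge int_vecB.
  have -> : int_vec K x - int_vec K x' = (int_vec K x - s x *: homogenize (w x))
     - (int_vec K x' - s x' *: homogenize (w x'))
     + ((s x - s x') *: homogenize (w x) + s x' *: (homogenize (w x) - homogenize (w x'))).
    by apply/rowP => i; rewrite !mxE; ring.
  apply: le_lt_trans (ler_normD _ _) _.
  apply: le_lt_trans (lerD (ler_normB _ _) (ler_normD _ _)) _.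
  rewrite !normrZ hh.
  have j1 : `|s x - s x'| * `|homogenize (w x)| <= (2 * h + 2 * (m * rho)) * R by exact: ler_pM.
  have j2 : (1 + R) * h = 8^-1 by rewrite /h; field; rewrite gt_eqF//; lra.
  have j3 : (1 + R) * (m * rho) <= 8^-1.
    have -> : 8^-1 = (1 + R) * ((1 + R) * ((F + 1) * delta)).
      by rewrite /delta; field; rewrite !gt_eqF//; lra.
    rewrite ler_wpM2l//; first lra.
    apply: le_trans mrho _; rewrite ler_wpM2l//; first lra.
    by rewrite ler_wpM2r ?ltW//; lra.
  rewrite mulrDl in j1; rewrite mulrDl mul1r in j2; rewrite mulrDl mul1r in j3.
  have j4 : 2 * h * R = 2 * (R * h) by ring.
  have j5 : 2 * (m * rho) * R = 2 * (R * (m * rho)) by ring.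
  rewrite j4 j5 in j1; lra.
- rewrite /C -mulrA ler_wpM2l// -exprMn.
  have hle : 2 * (Q0 * M) + 3 <= (2 * Q0 + 3) * M.
    have -> : (2 * Q0 + 3) * M = 2 * (Q0 * M) + 3 * M by ring.
    by rewrite lerD2l ler_peMr.
  by rewrite lerXn2r ?nnegrE//; lra.
Qed.

(** * Dyadic and layered sums *)

Lemma seq_has_max (K : realType) (T : eqType) (f : T -> K) (L : seq T) :
  (0 < size L)%N -> exists2 z, z \in L & {in L, forall x, f x <= f z}.
Proof.
elim: L => // x [_ _|y L IH _].
  by exists x; rewrite ?mem_head// => y; rewrite inE => /eqP->.
have [//|z zL zmax] := IH; have [xz|zx] := leP (f x) (f z).
  exists z; first by rewrite inE zL orbT.
  by move=> u; rewrite inE => /predU1P[->//|/zmax].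
exists x; first by rewrite mem_head.
move=> u; rewrite inE => /predU1P[->//|/zmax/le_trans]; apply; exact: ltW.
Qed.

Lemma size_filter_predC (T : eqType) (P : pred T) (L : seq T) :
  size L = (size (seq.filter P L) + size (seq.filter (predC P) L))%N.
Proof. by rewrite !size_filter count_predC. Qed.

Lemma size_filter_predC_lt (T : eqType) (P : pred T) (L : seq T) (z : T) :
  z \in L -> P z -> (size (seq.filter (predC P) L) < size L)%N.
Proof.
move=> zL Pz; rewrite [ltnRHS](size_filter_predC P) -{1}[size _]add0n ltn_add2r.
by rewrite size_filter -has_count; apply/hasP; exists z.
Qed.

(** Induction on the size. If [z] maximizes [g], the elements with [g x >= g z / 2] form one block;
    the others number at most [2 * C * (g z / 2) ^+ n], which is at most [C * g z ^+ n] because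
    [0 < n]. *)
Lemma dyadic_count (K : realType) (T : eqType) (X : set T) (g : T -> K) (C : K) (n : nat) :
  (0 < n)%N -> 0 <= C -> (forall x, X x -> 0 < g x) ->
  (forall (L : seq T) z, uniq L -> {in L, forall x, X x} -> X z ->
     {in L, forall x, g x <= g z <= 2 * g x} -> (size L)%:R <= C * g z ^+ n) ->
  forall (L : seq T) (m : K), uniq L -> {in L, forall x, X x} -> 0 <= m ->
    {in L, forall x, g x <= m} -> (size L)%:R <= 2 * C * m ^+ n.
Proof.
move=> n0 C0 g0 block L; have [k] := ubnP (size L); elim: k L => // k IH L.
rewrite ltnS => Lk m uL LX m0 Lm.
have [L0|L0] := posnP (size L).
  by rewrite L0 !mulr_ge0// exprn_ge0.
have [z zL zmax] := seq_has_max g L0.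
have Xz := LX z zL; have gz := g0 z Xz.
pose P x := g z <= 2 * g x.
have Pz : P z by rewrite /P; lra.
have h1 : (size (seq.filter P L))%:R <= C * g z ^+ n.
  apply: block; rewrite ?filter_uniq//.
    by move=> x; rewrite mem_filter => /andP[_ /LX].
  by move=> x; rewrite mem_filter => /andP[Px /zmax->].
have h2 : (size (seq.filter (predC P) L))%:R <= 2 * C * (g z / 2) ^+ n.
  apply: IH; rewrite ?filter_uniq//.
  - exact: leq_trans (size_filter_predC_lt zL Pz) Lk.
  - by move=> x; rewrite mem_filter => /andP[_ /LX].
  - by rewrite divr_ge0// ltW.
  - by move=> x; rewrite mem_filter /= -ltNge => /andP[? _]; lra.
have h3 : (g z / 2) ^+ n <= g z ^+ n / 2.
  rewrite expr_div_n ler_pM2l ?exprn_gt0// lef_pV2 ?posrE ?exprn_gt0//.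
  by rewrite ler_eXnr// ler1n.
have h4 : g z ^+ n <= m ^+ n by rewrite lerXn2r ?nnegrE ?Lm// ltW.
rewrite (size_filter_predC P) natrD.
have := ler_wpM2l C0 h3; have := ler_wpM2l C0 h4; lra.
Qed.

(** Induction on the size, from the minimum [g z]. The elements with [g x <= 2 * g z] contribute at
    most [D * (g z)^-1 ^+ b]; for the others [m] becomes [2 * g z], which at least halves the bound
    because [0 < b]. *)
Lemma dyadic_sum (K : realType) (T : eqType) (X : set T) (g : T -> K) (C : K) (n b : nat) :
  (0 < b)%N -> 0 <= C -> (forall x, X x -> 0 < g x) ->
  (forall (L : seq T) (m : K), uniq L -> {in L, forall x, X x} -> 0 <= m ->
    {in L, forall x, g x <= m} -> (size L)%:R <= C * m ^+ n) ->
  forall (L : seq T) (m : K), uniq L -> {in L, forall x, X x} -> 0 < m ->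
    {in L, forall x, m <= g x} ->
    \sum_(x <- L) (g x)^-1 ^+ (n + b) <= 2 * (C * 2 ^+ n) * m^-1 ^+ b.
Proof.
move=> b0 C0 g0 cnt L; have [k] := ubnP (size L); elim: k L => // k IH L.
rewrite ltnS => Lk m uL LX m0 Lm; set D := C * 2 ^+ n.
have D0 : 0 <= D by rewrite mulr_ge0// exprn_ge0.
have [/size0nil ->|L0] := posnP (size L).
  by rewrite big_nil !mulr_ge0// exprn_ge0// invr_ge0 ltW.
(* A maximum of [- g] is a minimum of [g]. *)
have [z zL zmin] := seq_has_max (fun x => - g x) L0.
have Xz := LX z zL; have gz := g0 z Xz.
pose P x := g x <= 2 * g z.
have Pz : P z by rewrite /P; lra.
set q := (g z)^-1 ^+ b; have q0 : 0 <= q by rewrite exprn_ge0// invr_ge0 ltW.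
have h1 : \sum_(x <- seq.filter P L) (g x)^-1 ^+ (n + b) <= D * q.
  apply: (@le_trans _ _ (\sum_(x <- seq.filter P L) (g z)^-1 ^+ (n + b))).
    rewrite big_seq [leRHS]big_seq; apply: ler_sum => x; rewrite mem_filter => /andP[_ xL].
    have gx := g0 x (LX x xL).
    have gzx : (g x)^-1 <= (g z)^-1 by rewrite lef_pV2 ?posrE// -lerN2 zmin.
    by rewrite lerXn2r ?nnegrE// invr_ge0 ltW.
  rewrite big_const_seq count_predT iter_addr_0 -[leLHS]mulr_natl.
  have : (size (seq.filter P L))%:R <= C * (2 * g z) ^+ n.
    apply: cnt; rewrite ?filter_uniq//.
    - by move=> x; rewrite mem_filter => /andP[_ /LX].
    - by rewrite mulr_ge0// ltW.
    - by move=> x; rewrite mem_filter => /andP[].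
  move=> hc; apply: le_trans (ler_wpM2r _ hc) _.
    by rewrite exprn_ge0// invr_ge0 ltW.
  rewrite exprD mulrA -/q ler_wpM2r// exprMn -!mulrA -exprMn mulfV ?gt_eqF//.
  by rewrite expr1n mulr1.
have h2 : \sum_(x <- seq.filter (predC P) L) (g x)^-1 ^+ (n + b) <= 2 * D * (2 * g z)^-1 ^+ b.
  apply: IH; rewrite ?filter_uniq//.
  - exact: leq_trans (size_filter_predC_lt zL Pz) Lk.
  - by move=> x; rewrite mem_filter => /andP[_ /LX].
  - by rewrite mulr_gt0.
  - by move=> x; rewrite mem_filter /= -ltNge => /andP[/ltW].
have h3 : (2 * g z)^-1 ^+ b <= q / 2.
  rewrite invfM exprMn mulrC ler_wpM2l// exprVn lef_pV2 ?posrE ?exprn_gt0//.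
  by rewrite ler_eXnr// ler1n.
have h4 : q <= m^-1 ^+ b.
  have mz : (g z)^-1 <= m^-1 by rewrite lef_pV2 ?posrE// Lm.
  by rewrite lerXn2r ?nnegrE// invr_ge0 ltW.
rewrite (bigID P)/= -(big_filter _ P) -(big_filter _ (predC P)).
have := ler_wpM2l D0 h3; have := ler_wpM2l D0 h4.
lra.
Qed.

(** Summation by parts against the counting function [N]: the boundary term is bounded through
    [mu n * r n.+1 <= 1], the remaining sum through [V]. *)
Lemma layered_sum (K : realType) (T : eqType) (L : seq T) (tau : T -> nat)
    (r mu : nat -> K) (C V : K) :
  0 <= C -> {in L, forall x, (0 < tau x)%N} ->
  (forall n, 0 <= r n) -> (forall n, (0 < n)%N -> r n.+1 <= r n) ->
  (forall n, (0 < n)%N -> (count (fun x => tau x <= n)%N L)%:R <= C * mu n) ->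
  (forall n, (0 < n)%N -> mu n * r n.+1 <= 1) ->
  (forall n, \sum_(1 <= i < n) mu i * (r i - r i.+1) <= V) ->
  \sum_(x <- L) r (tau x) <= C * (1 + V).
Proof.
move=> C0 tau0 r0 rmono cnt mur muV.
pose N n : K := (count (fun x => tau x <= n)%N L)%:R.
have parts n : \sum_(x <- L | (tau x <= n)%N) r (tau x) =
    N n * r n.+1 + \sum_(1 <= i < n.+1) N i * (r i - r i.+1).
  elim: n => [|n IH].
    rewrite big_geq// addr0 /N.
    have -> : count (fun x => tau x <= 0)%N L = 0%N.
      apply/eqP; rewrite -leqn0 leqNgt -has_count; apply/hasPn => x /tau0.
      by rewrite -ltnNge.
    rewrite mul0r big_seq_cond big1// => x /andP[/tau0 h].
    by rewrite leqNgt h.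
  rewrite big_nat_recr//= (bigID (fun x => tau x <= n)%N)/=.
  rewrite (eq_bigl (fun x => tau x <= n)%N); last by move=> x /=; lia.
  rewrite IH (eq_bigl (fun x => tau x == n.+1)%N); last by move=> x /=; lia.
  rewrite (eq_bigr (fun=> r n.+1)) => [|x /eqP->//].
  rewrite big_const_seq iter_addr_0 -[_ *+ count _ _]mulr_natl.
  have -> : N n.+1 = N n + (count (fun x => tau x == n.+1)%N L)%:R.
    rewrite /N -natrD; congr (_%:R).
    elim: (L) => //= x l ->; lia.
  ring.
(* All layers are reached by [M]; the successor makes [M] positive, as the bounds on [N] and [mu]
   require. *)
pose M := (\max_(x <- L) tau x)%N.+1.
have -> : \sum_(x <- L) r (tau x) = \sum_(x <- L | (tau x <= M)%N) r (tau x).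
  rewrite big_seq_cond [RHS]big_seq_cond; apply: eq_bigl => x.
  rewrite andbT; case: (boolP (x \in L)) => //= xL; apply/esym/leqW.
  exact: leq_bigmax_seq.
rewrite parts mulrDr mulr1; apply: lerD.
  apply: le_trans (ler_wpM2r (r0 _) (cnt M _)) _ => //.
  by rewrite -mulrA ler_piMr// mur.
apply: (@le_trans _ _ (C * \sum_(1 <= i < M.+1) mu i * (r i - r i.+1))).
  rewrite mulr_sumr big_nat_cond [leRHS]big_nat_cond; apply: ler_sum => i.
  rewrite andbT => /andP[i0 _]; rewrite mulrA ler_wpM2r ?cnt// subr_ge0.
  exact: rmono.
exact: ler_wpM2l.
Qed.

(** * Convergence of the sum over the approximants *)

Lemma count_predID (T : Type) (p q : pred T) (L : seq T) :
  count p L = (count (fun x => p x && q x) L + count (fun x => p x && ~~ q x) L)%N.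
Proof. by elim: L => //= x L ->; case: (p x); case: (q x) => /=; lia. Qed.

Lemma approximant_sub (K : realType) (d : nat) (A : set 'rV[K]_d) (R : K)
    (eta eta' : K -> K) :
  (forall T, 1 <= T -> eta T <= eta' T) ->
  approximant A R eta `<=` approximant A R eta'.
Proof.
move=> le x [w [s [x0 Aw wR xs]]]; exists w, s; split => //.
by apply: le_trans xs _; apply: le; exact: norm_int_vec_ge1.
Qed.

Lemma ratio_le (K : realType) (psi : K -> K) (x y : K) :
  (forall T, 1 <= T -> 0 < psi T) -> nonincreasing_from1 psi -> 1 <= x -> 1 <= y ->
  (x / psi x <= y / psi y) = (x <= y).
Proof.
move=> psi0 mono x1 y1; have px := psi0 x x1; have py := psi0 y y1.
rewrite ler_pdivrMr// mulrAC ler_pdivlMr//; apply/idP/idP => [|xy].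
  apply: contraTT; rewrite -!ltNge => yx.
  have pyx := mono y x y1 (ltW yx).
  apply: (@le_lt_trans _ _ (y * psi y)); last by rewrite ltr_pM2r.
  by rewrite ler_pM2l//; lra.
apply: ler_pM => //; [lra|exact: ltW|exact: mono].
Qed.

(** [dyadic_count] for the ratio [|x| / psi |x|]. The ratio increases with the norm, so the norm of
    the largest element of a block serves as [M] in [approximants_block_count]. *)
Lemma approximants_count (K : realType) (d a b : nat) (R : K)
    (A B : set 'rV[K]_d) (psi : K -> K) :
  1 <= R -> B `<=` A -> affine_subspace b B -> affine_subspace a A -> (b < a)%N ->
  (forall T, 1 <= T -> 0 < psi T) -> nonincreasing_from1 psi ->
  badly_approximable psi B ->
  exists e C : K, [/\ 0 < e, 0 < C & forall (L : seq 'rV[int]_(1 + d)) (m : K),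
    uniq L -> {in L, forall x, approximant A R (fun T => e * psi T) x} -> 0 <= m ->
    {in L, forall x, `|int_vec K x| / psi `|int_vec K x| <= m} ->
    (size L)%:R <= C * m ^+ (a - b)].
Proof.
move=> R1 BA affB affA ba psi0 mono bad.
have [e [C [e0 C0 block]]] := approximants_block_count R1 BA affB affA psi0 mono bad.
exists e, (2 * C); split => //; first by rewrite mulr_gt0.
pose X := approximant A R (fun T => e * psi T).
have X1 x : X x -> 1 <= `|int_vec K x|.
  by move=> [w [s [x0 _ _ _]]]; exact: norm_int_vec_ge1.
apply: (@dyadic_count K _ X (fun x => `|int_vec K x| / psi `|int_vec K x|)).
- by rewrite subn_gt0.
- exact: ltW.
- by move=> x /X1 x1; rewrite divr_gt0 ?psi0//; lra.
- move=> L z uL LX Xz Lz; apply: block => //; first exact: X1.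
    move=> x xL; have /andP[h _] := Lz x xL.
    by rewrite (ratio_le psi0 mono) in h => //; apply: X1 => //; apply: LX.
  by move=> x xL; have /andP[] := Lz x xL.
Qed.

(** As [phi <= psi], each term is at most the ratio to the power [- a]. The count grows with
    exponent [a - b], so the excess [b] makes the dyadic blocks sum geometrically. *)
Lemma approximants_sum_bounded_pos (K : realType) (d a b : nat) (R : K)
    (A B : set 'rV[K]_d) (psi phi : K -> K) :
  1 <= R -> B `<=` A -> affine_subspace b B -> affine_subspace a A -> (0 < b < a)%N ->
  (forall T, 1 <= T -> 0 < psi T) -> (forall T, 1 <= T -> 0 < phi T) ->
  nonincreasing_from1 psi -> (forall T, 1 <= T -> phi T <= psi T) ->
  badly_approximable psi B ->
  exists e S : K, 0 < e /\ forall L : seq 'rV[int]_(1 + d), uniq L ->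
    {in L, forall x, approximant A R (fun T => e * phi T) x} ->
    \sum_(x <- L) (phi `|int_vec K x| / `|int_vec K x|) ^+ a <= S.
Proof.
move=> R1 BA affB affA /andP[b0 ba] psi0 phi0 mono phipsi bad.
have [e [C [e0 C0 cnt]]] := approximants_count R1 BA affB affA ba psi0 mono bad.
pose X := approximant A R (fun T => e * psi T).
have X1 x : X x -> 1 <= `|int_vec K x|.
  by move=> [w [s [x0 _ _ _]]]; exact: norm_int_vec_ge1.
pose g (x : 'rV[int]_(1 + d)) := `|int_vec K x| / psi `|int_vec K x|.
have g0 x : X x -> 0 < g x by move=> /X1 x1; rewrite divr_gt0 ?psi0//; lra.
have sum := @dyadic_sum K _ X g C (a - b) b b0 (ltW C0) g0 cnt.
(* [1 / psi 1] is the least possible ratio, that of norm 1. *)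
exists e, (2 * (C * 2 ^+ (a - b)) * (1 / psi 1)^-1 ^+ b); split => // L uL LX.
have {}LX : {in L, forall x, X x}.
  move=> x /LX; apply: approximant_sub => T T1; by rewrite ler_pM2l// phipsi.
apply: le_trans (sum L (1 / psi 1) uL LX _ _); last first.
- by move=> x /LX/X1 x1; rewrite (ratio_le psi0 mono).
- by rewrite divr_gt0 ?psi0.
rewrite subnK ?(ltnW ba)//.
rewrite big_seq [leRHS]big_seq; apply: ler_sum => x /LX/X1 x1.
have p0 := phi0 _ x1; have x0 : 0 < `|int_vec K x| by lra.
have p0' := psi0 _ x1; rewrite /g invf_div.
have xle : phi `|int_vec K x| / `|int_vec K x| <= psi `|int_vec K x| / `|int_vec K x|.
  by rewrite ler_wpM2r ?invr_ge0// phipsi.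
by rewrite lerXn2r ?nnegrE// divr_ge0// ltW.
Qed.

(** Vectors of norm at least [R] are layered by [tau x], the integer part of [|x| / R]. Each term is
    at most [r (tau x)], and [lambda_] is the difference of consecutive values of [r], so
    [layered_sum] leads to the given series. *)
Lemma approximants_sum_bounded_point (K : realType) (d a : nat) (R : K)
    (A B : set 'rV[K]_d) (psi phi : K -> K) :
  1 <= R -> B `<=` A -> affine_subspace 0 B -> affine_subspace a A -> (0 < a)%N ->
  (forall T, 1 <= T -> 0 < psi T) -> (forall T, 1 <= T -> 0 < phi T) ->
  nonincreasing_from1 psi -> nonincreasing_from1 phi ->
  (forall T, 1 <= T -> phi T <= psi T) ->
  badly_approximable psi B ->
  cvgn (fun n : nat => \sum_(1 <= T < n) mu_ a 0 psi R T * lambda_ a phi R T) ->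
  exists e S : K, 0 < e /\ forall L : seq 'rV[int]_(1 + d), uniq L ->
    {in L, forall x, approximant A R (fun T => e * phi T) x} ->
    \sum_(x <- L) (phi `|int_vec K x| / `|int_vec K x|) ^+ a <= S.
Proof.
move=> R1 BA affB affA a0 psi0 phi0 mono phimono phipsi bad cv.
have [e [C [e0 C0 cnt]]] := approximants_count R1 BA affB affA a0 psi0 mono bad.
rewrite subn0 in cnt.
have [p [f [ff AE]]] := affine_subspace_chart affA.
have [h [C' [h0 C'0 shell]]] := approximants_shell_count p R1 ff.
rewrite -AE in shell.
have phi1 := phi0 1 (lexx 1).
(* The second bound keeps the tolerance at most [h], for the shell count. *)
pose e' := Num.min e (h / phi 1).
have e'0 : 0 < e' by rewrite lt_min e0 divr_gt0.
have e'h T : 1 <= T -> e' * phi T <= h.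
  move=> T1; apply: (@le_trans _ _ (h / phi 1 * phi 1)).
    by rewrite ler_pM ?phimono// ?ge_min ?lexx ?orbT// ltW// phi0.
  by rewrite divfK// gt_eqF.
have [V VP] : exists V : K, forall n, \sum_(1 <= T < n) mu_ a 0 psi R T * lambda_ a phi R T <= V.
  have [V [_ VP]] := cvg_seq_bounded cv; exists (V + 1) => n.
  apply: le_trans (ler_norm _) _.
  by have := VP (V + 1); rewrite ltrDl => /(_ ltr01); apply.
have R0 : 0 < R by lra.
have RT (n : nat) : (0 < n)%N -> 1 <= R * n%:R.
  by move=> n0; rewrite -[leLHS]mulr1 ler_pM// ler1n.
pose r n := (phi (R * n%:R) / n%:R) ^+ a.
pose mu n := (n%:R / psi (R * n%:R)) ^+ a.
have r0 n : 0 <= r n.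
  (* Nothing is known of [phi] at 0, but the inverse of 0 is 0, so [r 0] is [0 ^+ a]. *)
  case: n => [|n]; first by rewrite /r invr0 mulr0 exprn_ge0.
  by rewrite exprn_ge0// divr_ge0// ltW// phi0// RT.
have u_mono n : (0 < n)%N -> phi (R * n.+1%:R) / n.+1%:R <= phi (R * n%:R) / n%:R.
  move=> n0; apply: ler_pM; rewrite ?invr_ge0//.
  - by rewrite ltW// phi0// RT.
  - by rewrite phimono// ?RT// ler_pM2l// ler_nat.
  - by rewrite lef_pV2 ?posrE ?ltr0n// ler_nat.
have r_mono n : (0 < n)%N -> r n.+1 <= r n.
  move=> n0; rewrite lerXn2r ?nnegrE ?u_mono//.
    by rewrite divr_ge0// ltW// phi0// RT.
  by rewrite divr_ge0// ltW// phi0// RT.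
have mur n : (0 < n)%N -> mu n * r n.+1 <= 1.
  move=> n0; rewrite -exprMn exprn_ile1//.
    by rewrite mulr_ge0// divr_ge0// ltW// ?psi0 ?phi0// RT.
  apply: le_trans (ler_wpM2l _ (u_mono n n0)) _.
    by rewrite divr_ge0// ltW// psi0// RT.
  have pn := psi0 _ (RT n n0); have n0' : 0 < n%:R :> K by rewrite ltr0n.
  have -> : n%:R / psi (R * n%:R) * (phi (R * n%:R) / n%:R) = phi (R * n%:R) / psi (R * n%:R).
    by field; rewrite !gt_eqF.
  by rewrite ler_pdivrMr// mul1r phipsi// RT.
(* The first summand serves the norms up to [R * n], the second those between [R * n] and
   [R * n.+1]. *)
pose D := C * R ^+ a + C' * R ^+ a * psi 1 ^+ a.
have D0 : 0 <= D.
  have p1 := psi0 1 (lexx 1).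
  by rewrite addr_ge0// ?mulr_ge0 ?exprn_ge0// ltW.
exists e', (C * (R / psi R) ^+ a * phi 1 ^+ a + D * (1 + V)); split => // L uL LX.
have LX' : {in L, forall x, approximant A R (fun T => e * psi T) x}.
  move=> x /LX; apply: approximant_sub => T T1.
  by apply: ler_pM; rewrite ?phipsi ?ge_min ?lexx// ltW// phi0.
have L1 : {in L, forall x, 1 <= `|int_vec K x|}.
  by move=> x /LX[w [s [x0 _ _ _]]]; exact: norm_int_vec_ge1.
have Lcnt (P : pred 'rV[int]_(1 + d)) m : 1 <= m -> {in L, forall x, P x -> `|int_vec K x| <= m} ->
    (count P L)%:R <= C * (m / psi m) ^+ a.
  move=> m1 Pm; rewrite -size_filter; apply: cnt.
  - by rewrite filter_uniq.
  - by move=> x; rewrite mem_filter => /andP[_ /LX'].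
  - by rewrite divr_ge0 ?ltW ?psi0//; lra.
  - move=> x; rewrite mem_filter => /andP[Px xL].
    by rewrite (ratio_le psi0 mono) ?L1// Pm.
(* The vectors of norm less than [R] would have [tau x = 0]. Their number is bounded, and each term
   is at most [phi 1 ^+ a]. *)
rewrite (bigID (fun x => `|int_vec K x| < R)) /=; apply: lerD.
  apply: (@le_trans _ _ ((count (fun x => `|int_vec K x| < R) L)%:R * phi 1 ^+ a)).
    rewrite mulr_natl -iter_addr_0 -big_const_seq.
    rewrite big_seq_cond [leRHS]big_seq_cond; apply: ler_sum => x /andP[xL _].
    have x1 := L1 x xL; have p0 := phi0 _ x1.
    have xle : phi `|int_vec K x| / `|int_vec K x| <= phi 1.
      rewrite ler_pdivrMr; last lra.
      by apply: le_trans (phimono _ _ (lexx 1) x1) _; rewrite ler_peMr// ltW.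
    by rewrite lerXn2r ?nnegrE ?divr_ge0// ltW.
  apply: ler_wpM2r; first by rewrite exprn_ge0// ltW.
  by apply: Lcnt => // x _ /ltW.
pose L2 := [seq x <- L | ~~ (`|int_vec K x| < R)].
pose tau (x : 'rV[int]_(1 + d)) := Num.truncn (`|int_vec K x| / R).
have L2P x : x \in L2 -> x \in L /\ R <= `|int_vec K x|.
  by rewrite mem_filter -leNgt => /andP[].
have tau0 : {in L2, forall x, (0 < tau x)%N}.
  by move=> x /L2P[xL xR]; rewrite truncn_gt0 ler_pdivlMr// mul1r.
have tau_le x : R * (tau x)%:R <= `|int_vec K x|.
  by rewrite mulrC -ler_pdivlMr// truncn_le divr_ge0// ltW.
have tau_lt x n : (tau x <= n)%N -> `|int_vec K x| <= R * n%:R + R.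
  rewrite truncn_le_nat ltr_pdivrMr// => /ltW; rewrite -natr1; lra.
rewrite -big_filter -/L2.
apply: (@le_trans _ _ (\sum_(x <- L2) r (tau x))).
  rewrite big_seq [leRHS]big_seq; apply: ler_sum => x xL2.
  have [xL xR] := L2P x xL2; have x1 := L1 x xL; have t0 := tau0 x xL2.
  have p0 := phi0 _ x1; have pt := phi0 _ (RT _ t0).
  have xle : phi `|int_vec K x| / `|int_vec K x| <= phi (R * (tau x)%:R) / (tau x)%:R.
    apply: ler_pM; rewrite ?invr_ge0//; first exact: ltW.
      by apply: phimono; rewrite ?RT// tau_le.
    rewrite lef_pV2 ?posrE ?ltr0n//; last lra.
    by apply: le_trans (tau_le x); rewrite ler_peMl.
  by rewrite lerXn2r ?nnegrE// divr_ge0// ltW.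
apply: (@layered_sum K _ L2 tau r mu) => //; last first.
  move=> n; apply: le_trans (VP n); apply: ler_sum => i _.
  by rewrite /mu_ /lambda_ subn0.
move=> n n0; set M := R * n%:R; have M1 := RT n n0.
have psiM := psi0 _ M1.
(* [tau x <= n] allows norms up to [R * n.+1], while [mu n] involves [psi] at [M] only: [Lcnt]
   handles the norms up to [M], [shell] the others. *)
pose P (x : 'rV[int]_(1 + d)) := `|int_vec K x| <= M.
have -> : count (fun x => tau x <= n)%N L2 =
    (count (fun x => (tau x <= n) && P x) L2 + count (fun x => (tau x <= n) && ~~ P x) L2)%N.
  exact: count_predID.
rewrite natrD mulrDl; apply: lerD.
  have -> : C * R ^+ a * mu n = C * (M / psi M) ^+ a.
    by rewrite -mulrA -exprMn mulrA.
  rewrite count_filter; apply: Lcnt => // x xL.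
  by move=> /andP[/andP[]].
apply: (@le_trans _ _ (C' * M ^+ a)).
  rewrite -size_filter; apply: (shell (fun T => e' * phi T)) => //.
  - by rewrite !filter_uniq.
  - by move=> x; rewrite mem_filter => /andP[_ /L2P[/LX]].
  - move=> x; rewrite mem_filter -ltNge => /andP[/andP[xn /ltW Mx] _].
    rewrite Mx /=.
    exact: tau_lt.
rewrite -!mulrA ler_pM2l// -!exprMn.
have hle : M <= R * (psi 1 * (n%:R / psi M)).
  rewrite ler_pM2l// mulrA ler_pdivlMr// mulrC ler_wpM2r//.
  exact: mono (lexx 1) M1.
have M0 : 0 <= M by apply: le_trans M1.
by rewrite lerXn2r ?nnegrE// (le_trans M0).
Qed.

(** * The covering *)

(** Each exceptional point lies in the ball of an approximant of tolerance [e' * phi]. The radii are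
    proportional to [e'], and for [e' <= e] these approximants are among those summed by [S], whence
    the factor [e' ^+ a]. *)
Lemma approximants_cover (K : realType) (d a : nat) (R : K) (phi : K -> K)
    (p : 'rV[K]_d) (f : a.-tuple 'rV[K]_d) (S : K) (e : K) :
  1 <= R -> (0 < a)%N -> free f -> (forall T, 1 <= T -> 0 < phi T) ->
  nonincreasing_from1 phi -> 0 < e ->
  (forall L : seq 'rV[int]_(1 + d), uniq L ->
    {in L, forall x, approximant (range (affine_chart p f)) R (fun T => e * phi T) x} ->
    \sum_(x <- L) (phi `|int_vec K x| / `|int_vec K x|) ^+ a <= S) ->
  exists2 C : K, 0 <= C & forall e' : K, 0 < e' -> e' <= e -> e' * phi 1 <= 2^-1 ->
    (lebesgue_outer (affine_chart p f @^-1` [set w | (`|w| <= R)%R /\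
       ~ badly_approximable_vector phi w]) <= (C * e' ^+ a)%:E)%E.
Proof.
move=> R1 a0 ff phi0 mono e0 sumS.
have [Cc Cc0 CcP] := affine_chart_expanding p ff.
have S0 : 0 <= S by have := sumS [::] isT; rewrite big_nil; apply.
pose C1 := Cc * (4 * R * (1 + R)).
have C10 : 0 <= C1 by rewrite !mulr_ge0 ?ltW//; lra.
exists (2 ^+ a * (C1 ^+ a * S)); first by rewrite !mulr_ge0// exprn_ge0.
move=> e' e'0 e'e e'2.
pose eta T := e' * phi T; pose A := range (affine_chart p f).
have eta2 T : 1 <= T -> eta T <= 2^-1.
  by move=> T1; apply: le_trans e'2; rewrite ler_pM2l// mono.
pose X := approximant A R eta.
have [w [s wsP]] := approximants_choice A R eta.
have /choice[t tP] x : exists t : 'rV[K]_a, X x -> w x = affine_chart p f t.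
  have [/wsP[_ [t _ wE] _ _]|nX] := pselect (X x); first by exists t.
  by exists 0.
pose h (x : 'rV[int]_(1 + d)) := C1 * e' * (phi `|int_vec K x| / `|int_vec K x|).
have h0 x : 0 <= h x.
  (* At the zero vector the radius is 0, by the convention for the inverse of 0. *)
  have [->|x0] := eqVneq x 0.
    rewrite /h; have -> : int_vec K (0 : 'rV[int]_(1 + d)) = 0 by apply/rowP => i; rewrite !mxE.
    by rewrite normr0 invr0 !mulr0.
  have x1 := norm_int_vec_ge1 K x0.
  apply: mulr_ge0; first by rewrite mulr_ge0// ltW.
  by rewrite divr_ge0// ltW// phi0.
have -> : 2 ^+ a * (C1 ^+ a * S) * e' ^+ a = 2 ^+ a * ((C1 * e') ^+ a * S).
  by rewrite [(C1 * e') ^+ a]exprMn; ring.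
apply: (@lebesgue_outer_le_sum_balls K _ a X t h) => //.
- move=> L uL LX; rewrite /h.
  under eq_bigr do rewrite [(C1 * e' * _) ^+ a]exprMn.
  rewrite -mulr_sumr ler_wpM2l//; first by rewrite exprn_ge0// mulr_ge0// ltW.
  apply: sumS => // x /LX; apply: approximant_sub => T T1.
  by rewrite /eta ler_pM2r// phi0.
- move=> u /= [uR nbad].
  have [x [s' [x0 xs']]] := not_badly_approximable_vector phi0 nbad e'0.
  have xu : approximates A R eta x (affine_chart p f u) s'.
    by split => //; [exists u|exact: ltW].
  have Xx : X x by exists (affine_chart p f u), s'.
  exists x => //=; apply: le_trans (CcP _ _) _.
  rewrite /h /C1 -!mulrA ler_pM2l// -tP// !mulrA.
  have := approximates_close R1 (eta2 _ (norm_int_vec_ge1 K x0)) xu (wsP x Xx).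
  by rewrite /eta !mulrA.
Qed.

Theorem theorem1 (K : realType) (d a b : nat) (R : K) (A B : set 'rV[K]_d)
    (psi phi : K -> K) :
  (1 <= d)%N ->
  1 <= R ->
  B `<=` A ->
  affine_subspace b B ->
  affine_subspace a A ->
  (b < a <= d)%N ->
  (forall T, 1 <= T -> 0 < psi T) ->
  (forall T, 1 <= T -> 0 < phi T) ->
  nonincreasing_from1 psi ->
  nonincreasing_from1 phi ->
  (forall T, 1 <= T -> phi T <= psi T) ->
  psi T @[T --> +oo] --> (0 : K) ->
  badly_approximable psi B ->
  cvgn (fun n : nat => \sum_(1 <= T < n) mu_ a b psi R T * lambda_ a phi R T) ->
  affine_ae a A (fun w => `|w| <= R -> badly_approximable_vector phi w).
Proof.
move=> _ R1 BA affB affA /andP[ba _] psi0 phi0 psi_mono phi_mono phipsi _ bad cv p f ff AE.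
have a0 : (0 < a)%N by exact: leq_ltn_trans ba.
have [e [S [e0 sumS]]] : exists e S : K, 0 < e /\ forall L : seq 'rV[int]_(1 + d), uniq L ->
    {in L, forall x, approximant A R (fun T => e * phi T) x} ->
    \sum_(x <- L) (phi `|int_vec K x| / `|int_vec K x|) ^+ a <= S.
  case: b => [|b] in affB ba cv.
    exact: (approximants_sum_bounded_point R1 BA affB affA a0 psi0 phi0 psi_mono phi_mono
      phipsi bad cv).
  exact: (approximants_sum_bounded_pos R1 BA affB affA ba psi0 phi0 psi_mono phipsi bad).
rewrite AE in sumS.
have [C C0 coverC] := approximants_cover R1 a0 ff phi0 phi_mono e0 sumS.
have -> : [set w | A w /\ ~ (`|w| <= R -> badly_approximable_vector phi w)] =
    A `&` [set w | `|w| <= R /\ ~ badly_approximable_vector phi w].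
  by apply/seteqP; split => w /= [Aw]; rewrite not_implyE.
have -> : affine_chart p f @^-1` (A `&` [set w | `|w| <= R /\ ~ badly_approximable_vector phi w])
    = affine_chart p f @^-1` [set w | `|w| <= R /\ ~ badly_approximable_vector phi w].
  by apply/seteqP; split => t /=; [move=> []|split=> //; rewrite AE; exists t].
apply/le_anti/andP; split; last exact: lebesgue_outer_ge0.
apply/lee_addgt0Pr => r r0; rewrite add0e.
have phi1 := phi0 1 (lexx 1).
(* The bound 1 gives [e' ^+ a <= e'], the bound [r / (C + 1)] gives [C * e' <= r]; the other two are
   the conditions of the covering. *)
pose e' := Num.min (Num.min e 1) (Num.min (2 * phi 1)^-1 (r / (C + 1))).
have e'0 : 0 < e' by rewrite !lt_min e0 ltr01 invr_gt0 mulr_gt0// divr_gt0//; lra.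
have e'e : e' <= e by rewrite !ge_min lexx.
have e'1 : e' <= 1 by rewrite !ge_min lexx orbT.
have e'p : e' <= (2 * phi 1)^-1 by rewrite !ge_min lexx !orbT.
have e'r : e' <= r / (C + 1) by rewrite !ge_min lexx !orbT.
apply: le_trans (coverC e' e'0 e'e _) _.
  by rewrite -ler_pdivlMr// -invfM.
rewrite lee_fin; apply: (@le_trans _ _ (C * e')).
  by rewrite ler_wpM2l// ler_iXnr// ltW.
by rewrite ler_pdivlMr in e'r; lra.
Qed.
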